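(* There exist universal constants $0<c\le C$ such that for every integer $d\ge 1$ and every integer $k\ge 2$ there exist a set $\mathcal{X}$ and a concept class $\mathcal{H}\subseteq\mathcal{Y}^{\mathcal{X}}$ with $\mathcal{Y}=\{0,1,\dots,k\}$ such that (1) $\mathsf{opt}_{\operatorname{full}}^{\operatorname{det}}(\mathcal{H})=d+1$; (2) $c\,dk\le \mathsf{opt}_{\operatorname{bandit}}^{\operatorname{det}}(\mathcal{H})\le C\,dk$; (3) $c(d+k)\le \mathsf{opt}_{\operatorname{bandit}}^{\operatorname{adap}}(\mathcal{H})\le C(d+k)$.
   Context: A concept class is a nonempty $\mathcal{H}\subseteq\mathcal{Y}^{\mathcal{X}}$; its induced pattern class $\mathcal{P}(\mathcal{H})$ is the set of finite sequences of examples $(x,y)\in\mathcal{X}\times\mathcal{Y}$ consistent with some $h\in\mathcal{H}$ (i.e. $h(x)=y$ for all examples), and $\mathsf{opt}(\mathcal{H}):=\mathsf{opt}(\mathcal{P}(\mathcal{H}))$ for each notion below. Online learning: in rounds $t=1,2,\dots$ the adversary presents $x_t$, the learner outputs a prediction $\hat y_t$ (a draw from a distribution depending on past observations and $x_t$; deterministic learners use point masses), and a mistake occurs if $\hat y_t\neq y_t$ for the true label $y_t$. Full-information feedback reveals $y_t$; bandit feedback reveals only whether $\hat y_t=y_t$. $\mathsf{opt}_{\operatorname{full}}^{\operatorname{det}}(\mathcal{P})$ (resp. $\mathsf{opt}_{\operatorname{bandit}}^{\operatorname{det}}(\mathcal{P})$) is the infimum over deterministic learners of the supremum over sequences $S\in\mathcal{P}$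 of the number of mistakes with full-information (resp. bandit) feedback. A bandit history is realizable by $\mathcal{P}$ if some assignment of true labels, agreeing with all the correct/incorrect observations, makes the labeled sequence an element of $\mathcal{P}$. An adaptive adversary in each round chooses $x_t$ from the history, sees the learner's distribution $\pi^{(t)}$, and chooses a distribution $\tau^{(t)}$ for $y_t$; $\hat y_t\sim\pi^{(t)}$, $y_t\sim\tau^{(t)}$; it must keep the history realizable for every $y_t$ in the support of $\tau^{(t)}$. $\mathsf{opt}_{\operatorname{bandit}}^{\operatorname{adap}}(\mathcal{P})=\inf_{\text{learner}}\sup_{\text{adversary}}$ expected mistakes with bandit feedback. *)

(* Defs.v *)
From HB Require Import structures.
From mathcomp Require Import all_boot all_order all_algebra.
From mathcomp Require Import all_classical all_reals ereal.
Set Implicit Arguments. Unset Strict Implicit. Unset Printing Implicit Defensive.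
Import Order.TTheory GRing.Theory Num.Theory.
Local Open Scope classical_set_scope.
Local Open Scope ring_scope.

Section OnlineLearning.
Variable R : realType.
Variables (X : Type) (Y : finType).

Definition pattern_class := set (seq (X * Y)).

Definition induced_patterns (H : set (X -> Y)) : pattern_class :=
  [set S | exists2 h, H h & all (fun p => h p.1 == p.2) S].

Definition full_learner := seq (X * Y) -> X -> Y.

Fixpoint mistakes_full (f : full_learner) (past : seq (X * Y)) (S : seq (X * Y)) : nat :=
  match S with
  | [::] => 0%N
  | (x, y) :: S' => ((f past x != y) + mistakes_full f (rcons past (x, y)) S')%N
  end.

Definition opt_full_det (P : pattern_class) : \bar R :=
  ereal_inf [set ereal_sup [set ((mistakes_full f [::] S)%:R)%:E | S in P]
            | f in [set: full_learner]].

(* A bandit observation: (x_t, prediction, whether the prediction was correct). *)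
Definition bandit_obs := (X * Y * bool)%type.

Definition bandit_realizable (P : pattern_class) (hist : seq bandit_obs) : Prop :=
  exists2 S : seq (X * Y), P S &
    map fst S = map (fun o => o.1.1) hist /\
    all2 (fun s o => (o.1.2 == s.2) == o.2) S hist.

Definition bandit_learner := seq bandit_obs -> X -> Y.

Fixpoint mistakes_bandit (f : bandit_learner) (past : seq bandit_obs) (S : seq (X * Y)) : nat :=
  match S with
  | [::] => 0%N
  | (x, y) :: S' =>
      let yh := f past x in
      ((yh != y) + mistakes_bandit f (rcons past (x, yh, yh == y)) S')%N
  end.

Definition opt_bandit_det (P : pattern_class) : \bar R :=
  ereal_inf [set ereal_sup [set ((mistakes_bandit f [::] S)%:R)%:E | S in P]
            | f in [set: bandit_learner]].

Definition is_dist (p : {ffun Y -> R}) : bool :=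
  [forall y, 0 <= p y] && (\sum_y p y == 1).

Record dist := Dist { pmf :> {ffun Y -> R}; _ : is_dist pmf }.

Definition rand_learner := seq bandit_obs -> X -> dist.

(* Full history seen by the adversary: (x_s, prediction yhat_s, true label y_s). *)
Definition adv_hist := seq (X * Y * Y).

Definition bandit_view (h : adv_hist) : seq bandit_obs :=
  map (fun e => (e.1.1, e.1.2, e.1.2 == e.2)) h.

(* Adaptive adversary: from the history chooses x_t (or stops, None);
   then, seeing the learner's distribution pi, chooses a distribution tau for y_t. *)
Record adversary := Adversary {
  adv_x : adv_hist -> option X;
  adv_y : adv_hist -> X -> dist -> dist }.

Definition admissible (P : pattern_class) (A : adversary) : Prop :=
  forall (h : adv_hist) (x : X) (pi : dist), adv_x A h = Some x ->
  forall yh y : Y, 0 < pi yh -> 0 < adv_y A h x pi y ->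
    bandit_realizable P (rcons (bandit_view h) (x, yh, yh == y)).

Fixpoint exp_mistakes (L : rand_learner) (A : adversary) (T : nat) (h : adv_hist) : R :=
  match T with
  | 0%N => 0
  | T'.+1 =>
    match adv_x A h with
    | None => 0
    | Some x =>
      let pi := L (bandit_view h) x in
      let tau := adv_y A h x pi in
      \sum_(yh : Y) \sum_(y : Y)
        pi yh * tau y * ((yh != y)%:R + exp_mistakes L A T' (rcons h (x, yh, y)))
    end
  end.

(* Expected mistakes of the whole (finite, adversary-terminated) game = sup over horizons. *)
Definition opt_bandit_adap (P : pattern_class) : \bar R :=
  ereal_inf [set ereal_sup [set r | exists (A : adversary) (T : nat),
                              admissible P A /\ r = (exp_mistakes L A T [::])%:E]
            | L in [set: rand_learner]].
End OnlineLearning.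

(* Main.v *)
(** Take X = nat and let expert j (1 <= j <= k) be the class of functions with values in
    {0, j} vanishing at most d times; H is the union of the k experts.  With full
    information the first nonzero label reveals j, after which only the d zeros can
    cost a mistake.  A deterministic bandit learner told "incorrect" on a fresh point
    where it predicted j has only used up one of the d zeros of expert j, so every
    answer can be "incorrect" until all k experts have exhausted their zeros.
    A randomized learner predicting 0 with probability 1/2 and every other label with
    probability 1/(2k) pays at most one unit per round, while each round decreases a
    potential starting at 2k + d + 1 by at least that much in expectation: label 0 is hit
    with probability 1/2 and consumes a zero, and a nonzero label is hit with
    probability 1/(2k), which identifies the expert. *)
Require Import Defs.
From HB Require Import structures.
From mathcomp Require Import all_boot all_order all_algebra.
From mathcomp Require Import all_classical all_reals ereal.
From mathcomp Require Import Rstruct zify ring lra.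
Import Order.TTheory GRing.Theory Num.Theory.
Local Open Scope classical_set_scope.
Local Open Scope ring_scope.

Set Implicit Arguments. Unset Strict Implicit. Unset Printing Implicit Defensive.

(** * Witness criteria and a potential bound for the optimal mistake counts *)

Section OptBounds.
Variables (R : realType) (X : Type) (Y : finType) (P : pattern_class X Y).

Lemma opt_full_det_le (f : full_learner X Y) (n : nat) :
  (forall S, P S -> (mistakes_full f [::] S <= n)%N) ->
  (opt_full_det R P <= (n%:R)%:E)%E.
Proof.
move=> fP; apply: (@le_trans _ _
  (ereal_sup [set ((mistakes_full f [::] S)%:R)%:E | S in P])).
  by apply: ereal_inf_lbound; exists f.
by apply: ge_ereal_sup => _ [S PS <-]; rewrite lee_fin ler_nat fP.
Qed.

Lemma opt_full_det_ge (n : nat) :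
  (forall f : full_learner X Y, exists2 S, P S & (n <= mistakes_full f [::] S)%N) ->
  ((n%:R)%:E <= opt_full_det R P)%E.
Proof.
move=> fP; apply: le_ereal_inf_tmp => _ [f _ <-].
have [S PS le_n] := fP f.
apply: (@le_trans _ _ ((mistakes_full f [::] S)%:R)%:E).
  by rewrite lee_fin ler_nat.
by apply: ereal_sup_ubound; exists S.
Qed.

Lemma opt_bandit_det_le (f : bandit_learner X Y) (n : nat) :
  (forall S, P S -> (mistakes_bandit f [::] S <= n)%N) ->
  (opt_bandit_det R P <= (n%:R)%:E)%E.
Proof.
move=> fP; apply: (@le_trans _ _
  (ereal_sup [set ((mistakes_bandit f [::] S)%:R)%:E | S in P])).
  by apply: ereal_inf_lbound; exists f.
by apply: ge_ereal_sup => _ [S PS <-]; rewrite lee_fin ler_nat fP.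
Qed.

Lemma opt_bandit_det_ge (n : nat) :
  (forall f : bandit_learner X Y,
     exists2 S, P S & (n <= mistakes_bandit f [::] S)%N) ->
  ((n%:R)%:E <= opt_bandit_det R P)%E.
Proof.
move=> fP; apply: le_ereal_inf_tmp => _ [f _ <-].
have [S PS le_n] := fP f.
apply: (@le_trans _ _ ((mistakes_bandit f [::] S)%:R)%:E).
  by rewrite lee_fin ler_nat.
by apply: ereal_sup_ubound; exists S.
Qed.

Lemma opt_bandit_adap_ge (r : R) :
  (forall L : rand_learner R X Y, exists A T,
     admissible P A /\ r <= exp_mistakes L A T [::]) ->
  (r%:E <= opt_bandit_adap R P)%E.
Proof.
move=> LP; apply: le_ereal_inf_tmp => _ [L _ <-].
have [A [T [admA le_r]]] := LP L.
apply: (@le_trans _ _ (exp_mistakes L A T [::])%:E); first by rewrite lee_fin.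
by apply: ereal_sup_ubound; exists A, T.
Qed.

Lemma dist_ge0 (p : dist R Y) y : 0 <= p y.
Proof. by case: p => p /= /andP[/forallP/(_ y)]. Qed.

Lemma dist_sum1 (p : dist R Y) : \sum_y p y = 1.
Proof. by case: p => p /= /andP[_ /eqP]. Qed.

Lemma is_dist_dirac (y0 : Y) : is_dist [ffun y => (y == y0)%:R : R].
Proof.
apply/andP; split; first by apply/forallP => y; rewrite ffunE ler0n.
rewrite (bigD1 y0) //= ffunE eqxx big1 ?addr0 // => y /negPf yN.
by rewrite ffunE yN.
Qed.

Definition dirac (y0 : Y) : dist R Y := Dist (is_dist_dirac y0).

Lemma sum_dirac (y0 : Y) (F : Y -> R) : \sum_y dirac y0 y * F y = F y0.
Proof.
rewrite (bigD1 y0) //= ffunE eqxx mul1r big1 ?addr0 // => y /negPf yN.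
by rewrite ffunE yN mul0r.
Qed.

Lemma dist_sum_neq (p : dist R Y) (y0 : Y) : \sum_y p y * (y != y0)%:R = 1 - p y0.
Proof.
rewrite (bigD1 y0) //= eqxx mulr0 add0r.
under eq_bigr => y -> do rewrite mulr1.
by rewrite -(dist_sum1 p) [in RHS](bigD1 y0) //= addrAC subrr add0r.
Qed.

Lemma bandit_view_rcons (h : adv_hist X Y) x yh y :
  bandit_view (rcons h (x, yh, y)) = rcons (bandit_view h) (x, yh, yh == y).
Proof. by rewrite /bandit_view map_rcons. Qed.

(** The expectation is affine in the law of the true label, so a potential that pays for each label
    in its support pays for the whole round; admissibility supplies the realizability hypothesis for
    exactly those labels. *)
Lemma exp_mistakes_le (L : rand_learner R X Y) (phi : seq (bandit_obs X Y) -> R) :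
  (forall hist, 0 <= phi hist) ->
  (forall hist x y,
     (forall yh, 0 < L hist x yh ->
        bandit_realizable P (rcons hist (x, yh, yh == y))) ->
     \sum_yh L hist x yh * ((yh != y)%:R + phi (rcons hist (x, yh, yh == y)))
       <= phi hist) ->
  forall A T h, admissible P A -> exp_mistakes L A T h <= phi (bandit_view h).
Proof.
move=> phi_ge0 phi_step A T h admA; elim: T h => [|T IH] h //=.
case Ax: (adv_x A h) => [x|] //.
set pi := L _ x; set tau := adv_y A h x pi.
rewrite exchange_big /=.
have -> : phi (bandit_view h) = \sum_y tau y * phi (bandit_view h).
  by rewrite -mulr_suml dist_sum1 mul1r.
apply: ler_sum => y _.
have [tau0|tau_neq0] := eqVneq (tau y) 0.
  by rewrite tau0 mul0r big1 // => yh _; rewrite mulr0 mul0r.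
have tau_gt0 : 0 < tau y by rewrite lt_neqAle eq_sym tau_neq0 dist_ge0.
under eq_bigr do rewrite mulrAC mulrC.
rewrite -mulr_sumr ler_pM2l //.
apply: le_trans (phi_step (bandit_view h) x y _); last first.
  by move=> yh pi_gt0; apply: admA tau_gt0.
apply: ler_sum => yh _; apply: ler_wpM2l; first exact: dist_ge0.
by rewrite lerD2l -bandit_view_rcons IH.
Qed.

Lemma opt_bandit_adap_le (L : rand_learner R X Y) (r : R) :
  (forall A T, admissible P A -> exp_mistakes L A T [::] <= r) ->
  (opt_bandit_adap R P <= r%:E)%E.
Proof.
move=> LP; apply: (@le_trans _ _
  (ereal_sup [set s | exists (A : adversary R X Y) (T : nat),
                admissible P A /\ s = (exp_mistakes L A T [::])%:E])).
  by apply: ereal_inf_lbound; exists L.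
by apply: ge_ereal_sup => _ [A [T [admA ->]]]; rewrite lee_fin LP.
Qed.

(** Point-mass labels suffice for both adaptive lower bounds. Play stops as soon as [I] fails, so
    [I] doubles as the invariant of the histories on which a point is presented. *)
Definition pure_adversary (I : pred (adv_hist X Y)) (xs : adv_hist X Y -> X)
    (ys : adv_hist X Y -> dist R Y -> Y) : adversary R X Y :=
  Adversary (fun h => if I h then Some (xs h) else None)
    (fun h _ pi => dirac (ys h pi)).

Lemma pure_adversary_admissible (I : pred (adv_hist X Y)) xs
    (ys : adv_hist X Y -> dist R Y -> Y) :
  (forall h pi yh, I h ->
     bandit_realizable P
       (rcons (bandit_view h) (xs h, yh, yh == ys h pi))) ->
  admissible P (pure_adversary I xs ys).
Proof.
move=> Ireal h x pi /=; case: ifP => // Ih [<-] yh y _.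
by rewrite ffunE; have [->|_] := eqVneq y (ys h pi); rewrite ?ltxx // => _; apply: Ireal.
Qed.

Lemma exp_mistakes_pure (L : rand_learner R X Y) (I : pred (adv_hist X Y)) xs
    (ys : adv_hist X Y -> dist R Y -> Y) T h : I h ->
  let y := ys h (L (bandit_view h) (xs h)) in
  exp_mistakes L (pure_adversary I xs ys) T.+1 h =
    \sum_yh L (bandit_view h) (xs h) yh *
      ((yh != y)%:R + exp_mistakes L (pure_adversary I xs ys) T (rcons h (xs h, yh, y))).
Proof.
move=> Ih y /=; rewrite Ih; apply: eq_bigr => yh _.
under eq_bigr do rewrite -mulrA mulrCA.
exact: sum_dirac.
Qed.

End OptBounds.

(** * The union of the expert classes *)

Section Experts.
Variables d k : nat.
Local Notation Y := 'I_k.+1.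
Local Notation obs := (bandit_obs nat Y).
Implicit Types (f : nat -> Y) (j y : Y) (x : nat) (hist : seq obs) (p q : pred obs).

(** Duplicate-free lists of zeros bound their number without any cardinality of subsets of [nat]. *)
Definition expert j : set (nat -> Y) :=
  [set f | (forall x, (f x == ord0) || (f x == j)) /\
           forall s, uniq s -> all (fun x => f x == ord0) s -> (size s <= d)%N].

Definition experts : set (nat -> Y) := [set f | exists2 j, j != ord0 & expert j f].

(** Realizability in every lower bound is certified by such a function. *)
Definition expert_of j (s : seq nat) : nat -> Y := fun x => if x \in s then ord0 else j.

Lemma expert_ofP j s : j != ord0 -> (size s <= d)%N -> expert j (expert_of j s).
Proof.
move=> j_neq0 le_sd; split=> [x|t t_uniq /allP t0].
  by rewrite /expert_of; case: ifP; rewrite eqxx ?orbT.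
apply: leq_trans le_sd; apply: uniq_leq_size => // x /t0.
by rewrite /expert_of; case: ifP => // _; rewrite (negPf j_neq0).
Qed.

Lemma experts_neq0 : (0 < k)%N -> experts !=set0.
Proof.
move=> k_gt0; exists (expert_of ord_max [::]).
by exists ord_max; [rewrite -lt0n | apply: expert_ofP; rewrite // -lt0n].
Qed.

Lemma expert_label j f x : expert j f -> f x != ord0 -> f x = j.
Proof. by case=> /(_ x) /orP[/eqP->|/eqP//]; rewrite eqxx. Qed.

(** * Consistent functions and the zeros that bandit feedback reveals *)

Definition consistent f hist := all (fun o => (o.1.2 == f o.1.1) == o.2) hist.

(** The labels of a realizing sequence are forced by its function and the queried points, so only
    the function remains to be found. *)
Lemma bandit_realizableP (H : set (nat -> Y)) hist :
  bandit_realizable (induced_patterns H) hist <-> exists2 f, H f & consistent f hist.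
Proof.
split=> [[S [f Hf fS] [Sx Sy]]|[f Hf fhist]].
  exists f => //; elim: S hist fS Sx Sy => [|[x y] S IH] [|[[x' yh] b] hist] //=.
  move=> /andP[/eqP fx fS] [<- Sx] /andP[Sy1 Sy2].
  by rewrite fx Sy1 /= IH.
exists [seq (o.1.1, f o.1.1) | o <- hist].
  by exists f => //; rewrite all_map; apply/allP => o _ /=.
split; first by rewrite -map_comp.
by elim: hist fhist => //= o hist IH /andP[-> /IH].
Qed.

Lemma consistent_rcons f hist o :
  consistent f (rcons hist o) = ((o.1.2 == f o.1.1) == o.2) && consistent f hist.
Proof. exact: all_rcons. Qed.

(* If expert [j] is the correct one, a point shown to have label [0]. *)
Definition reveals_zero j (o : obs) := if o.2 then o.1.2 == ord0 else o.1.2 == j.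

Definition hits_zero (o : obs) := o.2 && (o.1.2 == ord0).

(** An expert limits its distinct zeros, so a point queried twice must count once. *)
Definition points (p : pred obs) hist := undup [seq o.1.1 | o <- hist & p o].

Lemma pointsP p hist x :
  reflect (exists2 o, o \in hist & p o /\ o.1.1 = x) (x \in points p hist).
Proof.
rewrite mem_undup; apply: (iffP mapP) => [[o]|[o oh [po <-]]].
  by rewrite mem_filter => /andP[po oh] ->; exists o.
by exists o; rewrite // mem_filter po.
Qed.

Lemma points_sub p q hist o : subpred p q ->
  {subset points p hist <= points q (rcons hist o)}.
Proof.
move=> pq x /pointsP[o' oh [/pq po' <-]]; apply/pointsP; exists o' => //.
by rewrite mem_rcons inE oh orbT.
Qed.

Lemma size_points_sub p q hist o : subpred p q ->
  (size (points p hist) <= size (points q (rcons hist o)))%N.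
Proof.
move=> pq; apply: uniq_leq_size; first exact: undup_uniq.
by move=> x; apply: points_sub.
Qed.

Lemma size_points_new p hist o : p o -> o.1.1 \notin points p hist ->
  (size (points p hist) < size (points p (rcons hist o)))%N.
Proof.
move=> po new; apply: (@uniq_leq_size _ (o.1.1 :: points p hist)).
  by rewrite /= new undup_uniq.
move=> x; rewrite inE => /orP[/eqP->|]; last exact: points_sub.
by apply/pointsP; exists o; rewrite // mem_rcons mem_head.
Qed.

Lemma hits_zero_reveals j : subpred hits_zero (reveals_zero j).
Proof. by case=> -[x y] []. Qed.

Lemma revealed_zero j f hist x : j != ord0 -> expert j f -> consistent f hist ->
  x \in points (reveals_zero j) hist -> f x = ord0.
Proof.
move=> j0 jf /allP cf /pointsP[[[x' y] b] /cf /= fo [ro /= <-]].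
move: ro fo; rewrite /reveals_zero /=; case: b => /eqP->; first by move/eqP/eqP.
rewrite eqbF_neg => jN; apply/eqP; apply: contraNT jN.
by move=> /(expert_label jf) ->.
Qed.

Lemma hit_zero f hist x : consistent f hist -> x \in points hits_zero hist -> f x = ord0.
Proof.
move=> /allP cf /pointsP[[[x' y] b] /cf /= fo [/andP[/= bT /eqP yE] <-]].
by move: fo; rewrite bT yE => /eqP/eqP.
Qed.

Lemma size_revealed_zero j f hist : j != ord0 -> expert j f -> consistent f hist ->
  (size (points (reveals_zero j) hist) <= d)%N.
Proof.
move=> j0 jf cf; apply: jf.2 (undup_uniq _) _.
by apply/allP => x /(revealed_zero j0 jf cf)/eqP.
Qed.

Lemma size_hit_zero f hist : experts f -> consistent f hist ->
  (size (points hits_zero hist) <= d)%N.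
Proof.
move=> [j _ jf] cf; apply: jf.2 (undup_uniq _) _.
by apply/allP => x /(hit_zero cf)/eqP.
Qed.

(** * Deterministic bandit learning: upper bound, then lower bound *)

Definition alive j hist : bool := `[< exists2 f, expert j f & consistent f hist >].

Lemma alive_rcons j hist o : alive j (rcons hist o) -> alive j hist.
Proof.
by move=> /asboolP[f jf]; rewrite consistent_rcons => /andP[_ cf]; apply/asboolP; exists f.
Qed.

(** For [j != ord0], an alive expert has at most [d] revealed zeros, so its budget is at least one;
    this extra unit pays for the mistake that eliminates it. *)
Definition budget j hist : nat :=
  if alive j hist then (d.+1 - size (points (reveals_zero j) hist))%N else 0%N.

Definition total_budget hist : nat := (\sum_(j | j != ord0) budget j hist)%N.

Lemma budget_rcons j hist o : (budget j (rcons hist o) <= budget j hist)%N.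
Proof.
rewrite /budget; case: ifP => // /alive_rcons ->.
by apply: leq_sub2l; apply: size_points_sub.
Qed.

Lemma total_budget_rcons hist o : (total_budget (rcons hist o) <= total_budget hist)%N.
Proof. by apply: leq_sum => j _; apply: budget_rcons. Qed.

Definition expert_prediction j hist x : Y :=
  if x \in points (reveals_zero j) hist then ord0 else j.

(** On a known zero the prediction is [ord0], and its failure eliminates the expert. Elsewhere the
    prediction is [j], and its failure eliminates the expert or reveals a new zero. *)
Lemma budget_mistake j hist x : j != ord0 -> alive j hist ->
  (budget j (rcons hist (x, expert_prediction j hist x, false)) < budget j hist)%N.
Proof.
move=> j0 aj; rewrite /budget aj; move/asboolP: (aj) => [f jf cf].
have le_d := size_revealed_zero j0 jf cf.
case: ifP => [/asboolP[g jg]|_]; last by rewrite subn_gt0 ltnS.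
rewrite consistent_rcons /= /expert_prediction => /andP[gx cg].
move: gx; case: ifPn => [xz|xNz] gx.
  by move: gx; rewrite (revealed_zero j0 jg cg xz) eqxx.
apply: ltn_sub2l; first by rewrite ltnS.
by apply: size_points_new; rewrite // /reveals_zero /= eqxx.
Qed.

(** A realizable history leaves some expert alive, so the default [ord0] is reached only on
    unrealizable ones. *)
Definition follow_alive : bandit_learner nat Y := fun hist x =>
  expert_prediction (odflt ord0 [pick j | (j != ord0) && alive j hist]) hist x.

Lemma total_budget_mistake f hist x : experts f -> consistent f hist ->
  (total_budget (rcons hist (x, follow_alive hist x, false)) < total_budget hist)%N.
Proof.
move=> [i i0 fi] cf; rewrite /follow_alive; case: pickP => [j /= /andP[j0 aj]|/(_ i)].
  rewrite /total_budget (bigD1 j) //= [ltnRHS](bigD1 j) //= -addSn leq_add //.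
    exact: budget_mistake.
  by apply: leq_sum => l _; apply: budget_rcons.
by rewrite i0 /=; move=> /negP[]; apply/asboolP; exists f.
Qed.

Lemma total_budget0 : (total_budget [::] <= k * d.+1)%N.
Proof.
rewrite /total_budget big_mkcond big_ord_recl eqxx /= add0n.
apply: leq_trans (_ : \sum_(i < k) d.+1 <= _)%N; last by rewrite sum_nat_const card_ord.
by apply: leq_sum => i _; rewrite /budget; do 2?case: ifP => // _; rewrite leq_subr.
Qed.

(** A correct nonzero label eliminates every other expert. A correct [ord0] is a revealed zero for
    all experts alike, so the survivor has already spent one unit per point hit. *)
Lemma total_budget_success j hist x : j != ord0 ->
  (total_budget (rcons hist (x, j, true)) <= d.+1 - size (points hits_zero hist))%N.
Proof.
move=> j0; rewrite /total_budget (bigD1 j) //= [X in (_ + X)%N]big1 ?addn0.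
  rewrite /budget; case: ifP => // _; apply/leq_sub2l/size_points_sub.
  exact: hits_zero_reveals.
move=> i /andP[i0 ij]; rewrite /budget; case: ifP => // /asboolP[f fi].
rewrite consistent_rcons /= => /andP[/eqP/eqP fx _].
by move: ij; rewrite -(expert_label fi _ (x := x)) -fx ?eqxx.
Qed.

Lemma mistakes_follow_alive f hist S : experts f -> consistent f hist ->
  all (fun e => f e.1 == e.2) S ->
  (mistakes_bandit follow_alive hist S <= total_budget hist)%N.
Proof.
move=> Ef; elim: S hist => [|[x y] S IH] hist cf //= /andP[/eqP fx fS].
set yh := follow_alive hist x.
have := IH (rcons hist (x, yh, yh == y)) _ fS.
rewrite consistent_rcons /= fx eqxx cf => /(_ isT) le_S.
have [yhy|yhNy] := eqVneq yh y.
  by rewrite yhy eqxx /= add0n in le_S *; apply: leq_trans le_S (total_budget_rcons _ _).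
rewrite (negPf yhNy) /= add1n in le_S *.
exact: leq_ltn_trans le_S (total_budget_mistake x Ef cf).
Qed.

Lemma opt_bandit_det_experts_le (R : realType) :
  (opt_bandit_det R (induced_patterns experts) <= ((k * d.+1)%N%:R)%:E)%E.
Proof.
apply: (@opt_bandit_det_le _ _ _ _ follow_alive) => S [f Ef fS].
exact: leq_trans (mistakes_follow_alive Ef (isT : consistent f [::]) fS) total_budget0.
Qed.

(* Always answering "incorrect" on fresh points, the adversary can still commit
   to an expert whose nonzero label was predicted at most [d] times. *)
Section AlwaysWrong.
Variable L : bandit_learner nat Y.

Fixpoint wrong_hist (n : nat) : seq obs :=
  if n is m.+1 then rcons (wrong_hist m) (m, L (wrong_hist m) m, false) else [::].

(** Pigeonhole: if each of the [k] nonzero labels were predicted more than [d] times, there would be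
    at least [k * d.+1] rounds, which exceeds [d * k]. *)
Lemma unpopular_label n : (0 < k)%N -> (n <= d * k)%N ->
  exists2 j : Y, j != ord0 &
    (size [seq t <- iota 0 n | L (wrong_hist t) t == j] <= d)%N.
Proof.
move=> k_gt0 le_n.
suff /existsP[j /andP[j0 le_d]] :
    [exists j : Y, (j != ord0) && (size [seq t <- iota 0 n | L (wrong_hist t) t == j] <= d)%N].
  by exists j.
apply: contraT; rewrite negb_exists => /forallP popular.
suff: (k * d.+1 <= n)%N by nia.
rewrite -[n in leqRHS](size_iota 0) -sum1_size.
rewrite (partition_big (fun t => L (wrong_hist t) t) predT) //=.
rewrite big_ord_recl.
apply: leq_trans (leq_addl _ _); rewrite -[X in (X * _)%N]card_ord -sum_nat_const.
apply: leq_sum => i _; rewrite -big_filter sum1_size ltnNge.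
by apply: contraNN (popular (lift ord0 i)) => le_d; rewrite le_d andbT.
Qed.

(** As long as every prediction misses, the actual history of the learner coincides with
    [wrong_hist]. *)
Lemma mistakes_always_wrong f n m :
  (forall t, (t < n + m)%N -> L (wrong_hist t) t != f t) ->
  mistakes_bandit L (wrong_hist n) [seq (t, f t) | t <- iota n m] = m.
Proof.
elim: m n => //= m IH n wrong.
have := wrong n; rewrite addnS ltnS leq_addr => /(_ isT) wr.
rewrite wr (negPf wr) add1n -[rcons _ _]/(wrong_hist n.+1) IH // => t.
by rewrite addSnnS; apply: wrong.
Qed.

End AlwaysWrong.

Lemma opt_bandit_det_experts_ge (R : realType) : (0 < k)%N ->
  (((d * k)%N%:R)%:E <= opt_bandit_det R (induced_patterns experts))%E.
Proof.
move=> k_gt0; apply: opt_bandit_det_ge => L.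
have [j j0 le_d] := unpopular_label L k_gt0 (leqnn _).
(* [z] collects the rounds in which [j] was predicted; labelling these [ord0] and all others [j]
   contradicts every prediction. *)
set z := [seq t <- _ | _] in le_d.
exists [seq (t, expert_of j z t) | t <- iota 0 (d * k)].
  exists (expert_of j z); first by exists j => //; apply: expert_ofP.
  by rewrite all_map; apply/allP => t _ /=.
rewrite (@mistakes_always_wrong L _ 0) // => t lt_t.
rewrite /expert_of mem_filter mem_iota lt_t /= andbT.
by case: ifPn => [/eqP->|//].
Qed.

(** * Full information: upper bound, then lower bound *)

Definition follow_label : full_learner nat Y := fun past x =>
  if [pick j | (j != ord0) && (j \in unzip2 past)] is Some j
  then (if (x, ord0) \in past then ord0 else j) else ord0.

Definition zeros (S : seq (nat * Y)) := undup [seq e.1 | e <- S & e.2 == ord0].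

Definition label_budget (past : seq (nat * Y)) : nat :=
  if has (fun e => e.2 != ord0) past then (d - size (zeros past))%N else d.+1.

Lemma zeros_rcons past x y :
  {subset zeros past <= zeros (rcons past (x, y))}.
Proof.
move=> z; rewrite !mem_undup filter_rcons; case: ifP => // _ z_in.
by rewrite map_rcons mem_rcons inE z_in orbT.
Qed.

Lemma size_zeros f past : experts f -> all (fun e => f e.1 == e.2) past ->
  (size (zeros past) <= d)%N.
Proof.
move=> [i _ fi] /allP fpast; apply: fi.2 (undup_uniq _) _.
apply/allP => z; rewrite mem_undup => /mapP[e].
by rewrite mem_filter => /andP[/eqP e0 /fpast /eqP fe] ->; rewrite fe e0.
Qed.

(** While only zeros have been seen, the sole possible mistake is on the first nonzero label, and
    the budget then falls from [d.+1] to at most [d]. Afterwards only a new zero is mispredicted,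
    and it uses up one unit. *)
Lemma label_budget_rcons f past x y : experts f ->
  all (fun e => f e.1 == e.2) (rcons past (x, y)) ->
  ((follow_label past x != y) + label_budget (rcons past (x, y)) <= label_budget past)%N.
Proof.
move=> Ef fpast'; have le_d := size_zeros Ef fpast'; move: Ef fpast' => [i i0 fi].
rewrite all_rcons /= => /andP[/eqP fx /allP fpast].
have le_z := uniq_leq_size (undup_uniq _) (@zeros_rcons past x y).
rewrite /follow_label /label_budget has_rcons /=.
case: pickP => [j /andP[j0 /mapP[e e_past je]]|no_label]; last first.
  have -> : has (fun e => e.2 != ord0) past = false.
    apply/negbTE/hasPn => e e_past; apply/negP => e0.
    by have := no_label e.2; rewrite e0 map_f.
  by rewrite orbF eq_sym; case: eqP => //= _; rewrite add1n ltnS leq_subr.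
have -> : has (fun e => e.2 != ord0) past by apply/hasP; exists e; rewrite -?je.
(* Any nonzero label seen in the past is the label of the true expert. *)
rewrite orbT; have -> : j = i.
  rewrite je -(eqP (fpast _ e_past)); apply: (expert_label fi).
  by rewrite (eqP (fpast _ e_past)) -je.
case: ifPn => [/fpast /= /eqP x0|xNz].
  by rewrite -[X in _ != X]fx x0 eqxx leq_sub2l.
have [_|iNy] := eqVneq i y; first by rewrite leq_sub2l.
have y0 : y = ord0.
  apply/eqP; apply: contraNT iNy; rewrite -fx.
  by move=> /(expert_label fi) ->.
suff: (size (zeros past) < size (zeros (rcons past (x, y))))%N.
  by move=> lt_z; rewrite add1n ltn_sub2l // (leq_trans lt_z).
apply: (@uniq_leq_size _ (x :: zeros past)).
  rewrite /= undup_uniq andbT mem_undup; apply/mapP => -[[x' y']].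
  by rewrite mem_filter /= => /andP[/eqP-> x_past] xE; rewrite xE x_past in xNz.
move=> z; rewrite inE => /orP[/eqP->|]; last exact: zeros_rcons.
by rewrite mem_undup filter_rcons y0 eqxx map_rcons mem_rcons mem_head.
Qed.

Lemma mistakes_follow_label f past S : experts f ->
  all (fun e => f e.1 == e.2) past -> all (fun e => f e.1 == e.2) S ->
  (mistakes_full follow_label past S <= label_budget past)%N.
Proof.
move=> Ef; elim: S past => [|[x y] S IH] past //= fpast /andP[fx fS].
have fpast' : all (fun e => f e.1 == e.2) (rcons past (x, y)).
  by rewrite all_rcons /= fx.
apply: leq_trans (label_budget_rcons Ef fpast').
by rewrite leq_add2l IH.
Qed.

Lemma mistakes_full_rcons (L : full_learner nat Y) past S x y :
  mistakes_full L past (rcons S (x, y)) =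
  (mistakes_full L past S + (L (past ++ S) x != y))%N.
Proof.
elim: S past => [|[x' y'] S IH] past /=; first by rewrite cats0 addn0.
by rewrite IH cat_rcons addnA.
Qed.

Section Contradict.
Variables (L : full_learner nat Y) (j : Y).

Fixpoint contradict (n : nat) : seq (nat * Y) :=
  if n is m.+1 then
    let past := contradict m in
    rcons past (m, if L past m == j then ord0 else j)
  else [::].

Lemma mistakes_contradict n : j != ord0 -> mistakes_full L [::] (contradict n) = n.
Proof.
move=> j0; elim: n => //= n IH; rewrite mistakes_full_rcons IH /=.
by case: ifPn => [/eqP->|->]; rewrite ?j0 addn1.
Qed.

Lemma contradict_points n : unzip1 (contradict n) = iota 0 n.
Proof.
elim: n => // n IH; rewrite -[in RHS]addn1 iotaD -IH /= add0n cats1.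
by rewrite /unzip1 map_rcons.
Qed.

Lemma contradict_label n x y : (x, y) \in contradict n ->
  y = if L (contradict x) x == j then ord0 else j.
Proof.
elim: n => //= n IH; rewrite mem_rcons inE => /orP[/eqP[-> ->]|/IH] //.
Qed.

End Contradict.

Lemma opt_full_det_experts (R : realType) : (2 <= k)%N ->
  opt_full_det R (induced_patterns experts) = ((d + 1)%N%:R)%:E.
Proof.
move=> k2; apply/eqP; rewrite eq_le; apply/andP; split.
  apply: (@opt_full_det_le _ _ _ _ follow_label) => S [f Ef fS].
  by have := mistakes_follow_label Ef (isT : all _ [::]) fS; rewrite addn1.
apply: opt_full_det_ge => L.
(* With two nonzero labels available, [j] can avoid the first prediction. Point 0 then gets label
   [j], so the [d.+1] contradicting rounds contain at most [d] zeros. *)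
have [j j0 jL] : exists2 j : Y, j != ord0 & L [::] 0%N != j.
  have [L1|LN1] := eqVneq (L [::] 0%N) (inord 1).
    exists (inord 2); rewrite ?L1 -val_eqE /= !inordK //; lia.
  by exists (inord 1); rewrite // -val_eqE /= inordK //; lia.
exists (contradict L j d.+1); last by rewrite mistakes_contradict // addn1.
pose z := [seq x <- iota 1 d | L (contradict L j x) x == j].
exists (expert_of j z).
  exists j => //; apply: expert_ofP => //.
  by rewrite size_filter -[X in (_ <= X)%N](size_iota 1) count_size.
apply/allP => -[x y] xy; rewrite (contradict_label xy) /= /expert_of mem_filter mem_iota.
have : x \in unzip1 (contradict L j d.+1) by apply: (map_f fst xy).
rewrite contradict_points mem_iota /= add0n add1n => ->; rewrite andbT.
case: x xy => [|x] _; last by rewrite andbT; case: ifP.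
by rewrite andbF (negPf jL).
Qed.

End Experts.

(** * Adaptive adversaries: a randomized upper bound and two lower bounds *)

Section AdaptiveAdversary.
Variables (R : realType) (d k : nat).
Hypothesis k_gt0 : (0 < k)%N.
Local Notation Y := 'I_k.+1.
Local Notation obs := (bandit_obs nat Y).
Implicit Types (f : nat -> Y) (j y : Y) (x : nat) (hist : seq obs).
Local Notation P := (induced_patterns (experts d (k := k))).

Lemma is_dist_guess :
  is_dist [ffun y : Y => if y == ord0 then 2^-1 else (2 * k)%:R^-1 : R].
Proof.
apply/andP; split.
  by apply/forallP => y; rewrite ffunE; case: ifP => _; rewrite invr_ge0 ler0n.
rewrite big_ord_recl ffunE eqxx.
under eq_bigr do rewrite ffunE -val_eqE /=.
rewrite sumr_const card_ord -mulr_natr natrM.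
have : k%:R != 0 :> R by rewrite pnatr_eq0 -lt0n.
by move=> k0; apply/eqP; field.
Qed.

Definition guess : dist R Y := Dist is_dist_guess.

Lemma guess_gt0 y : 0 < guess y.
Proof.
by rewrite ffunE; case: ifP => _; rewrite invr_gt0 ltr0n // muln_gt0 k_gt0.
Qed.

(* The first correct nonzero guess identifies the expert. *)
Definition expert_found hist := has (fun o : obs => o.2 && (o.1.2 != ord0)) hist.

Definition guess_then_follow : rand_learner R nat Y := fun hist x =>
  if expert_found hist then dirac R (follow_alive d hist x)
  else if x \in points (@hits_zero k) hist then dirac R ord0 else guess.

(** The part [2 * k] is released by the first correct nonzero guess; the rest bounds the
    [total_budget] left at that moment, by [total_budget_success]. *)
Definition potential hist : nat :=
  if expert_found hist then total_budget d hist
  else (2 * k + (d.+1 - size (points (@hits_zero k) hist)))%N.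

Lemma potential_miss hist x y :
  (potential (rcons hist (x, y, false)) <= potential hist)%N.
Proof.
rewrite /potential /expert_found has_rcons /=; case: ifP => _.
  exact: total_budget_rcons.
by rewrite leq_add2l; apply: leq_sub2l; apply: size_points_sub.
Qed.

(** The boolean is the unit gained at a fresh zero; its size condition ensures that the truncated
    subtraction has a unit left to lose. *)
Lemma potential_hit_zero hist x : ~~ expert_found hist ->
  (potential (rcons hist (x, ord0, true)) +
    ((x \notin points (@hits_zero k) hist) &&
     (size (points (@hits_zero k) hist) <= d)) <= potential hist)%N.
Proof.
rewrite /potential /expert_found has_rcons /= => /negbTE ->.
rewrite -addnA leq_add2l; case: andP => [[new le_d]|_].
  have hit : @hits_zero k (x, ord0, true) by rewrite /hits_zero /= eqxx.
  by rewrite addn1 ltn_sub2l ?ltnS // size_points_new.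
by rewrite addn0; apply: leq_sub2l; apply: size_points_sub.
Qed.

Lemma potential_hit hist x j : ~~ expert_found hist -> j != ord0 ->
  (potential (rcons hist (x, j, true)) + 2 * k <= potential hist)%N.
Proof.
rewrite /potential /expert_found has_rcons /= => /negbTE -> j0; rewrite j0 /=.
by rewrite addnC leq_add2l; apply: total_budget_success.
Qed.

Lemma realizable_rcons hist x yh b : bandit_realizable P (rcons hist (x, yh, b)) ->
  exists2 f, experts d f & consistent f hist /\ b = (yh == f x).
Proof.
move=> /bandit_realizableP[f Ef]; rewrite consistent_rcons /= => /andP[/eqP fx cf].
by exists f.
Qed.

(** Only the true label [y] earns [gain], which enters the average with weight [guess y]. *)
Lemma sum_guess_le y (F : Y -> R) (M : R) (gain : R) :
  (forall yh, yh != y -> F yh <= M) -> F y <= M - gain ->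
  \sum_yh guess yh * F yh <= M - guess y * gain.
Proof.
move=> F_le Fy.
have -> : M - guess y * gain = \sum_yh guess yh * (M - (yh == y)%:R * gain).
  under [RHS]eq_bigr do rewrite mulrBr.
  rewrite sumrB -mulr_suml dist_sum1 mul1r; congr (_ - _).
  rewrite (bigD1 y) //= eqxx mul1r big1 ?addr0 // => yh /negPf ->.
  by rewrite mul0r mulr0.
apply: ler_sum => yh _; apply: ler_wpM2l; first exact: dist_ge0.
have [->|yhNy] := eqVneq yh y; first by rewrite mul1r.
by rewrite mul0r subr0 F_le.
Qed.

Lemma potential_step hist x y :
  (forall yh, 0 < guess_then_follow hist x yh ->
     bandit_realizable P (rcons hist (x, yh, yh == y))) ->
  \sum_yh guess_then_follow hist x yh *
     ((yh != y)%:R + (potential (rcons hist (x, yh, yh == y)))%:R)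
  <= (potential hist)%:R.
Proof.
rewrite /guess_then_follow; case: ifPn => [found|not_found].
  move/(_ (follow_alive d hist x)); rewrite ffunE eqxx => /(_ ltr01).
  move=> /realizable_rcons[f Ef [cf _]].
  rewrite sum_dirac -natrD ler_nat.
  rewrite /potential found /expert_found has_rcons -/(expert_found hist) found orbT.
  have [_|_] := eqVneq (follow_alive d hist x) y.
    exact: total_budget_rcons.
  exact: total_budget_mistake Ef cf.
case: ifPn => [known|new].
  move/(_ ord0); rewrite ffunE eqxx => /(_ ltr01) /realizable_rcons[f Ef [cf]].
  rewrite sum_dirac (hit_zero cf known) eqxx => ->; rewrite add0r ler_nat.
  by have := potential_hit_zero x not_found; rewrite known addn0.
(* [guess] has full support, so realizability may be applied to the correct prediction [y]
   itself. *)
move=> realizable; have [f Ef [cf _]] := realizable_rcons (realizable y (guess_gt0 y)).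
have le_d := size_hit_zero Ef cf.
have miss yh : yh != y ->
    (yh != y)%:R + (potential (rcons hist (x, yh, yh == y)))%:R
      <= (potential hist).+1%:R :> R.
  by move=> yhN; rewrite (negbTE yhN) -natrD add1n ler_nat ltnS potential_miss.
(* A miss is bounded by the potential plus one. Against that, a correct prediction saves the mistake
   and lowers the potential by 1 for [ord0], by [2 * k] otherwise; in both cases [guess y * gain] is
   at least 1. *)
pose gain : R := if y == ord0 then 2 else (2 * k).+1%:R.
apply: (le_trans (sum_guess_le (gain := gain) miss _)).
  rewrite eqxx add0r /gain; have [->|y0] := eqVneq y ord0.
    rewrite lerBrDr -natrD ler_nat.
    by have := potential_hit_zero x not_found; rewrite new le_d addn1 addn2.
  by rewrite lerBrDr -natrD ler_nat addnS ltnS potential_hit.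
rewrite -natr1 lerBlDr lerD2l /gain ffunE; case: ifP => _.
  by rewrite mulVf ?pnatr_eq0.
by rewrite ler_pdivlMl ?mulr1 ?ler_nat // ltr0n muln_gt0 k_gt0.
Qed.

Lemma opt_bandit_adap_experts_le :
  (opt_bandit_adap R P <= ((2 * k + d.+1)%N%:R)%:E)%E.
Proof.
apply: (@opt_bandit_adap_le _ _ _ _ guess_then_follow) => A T.
exact: (exp_mistakes_le (phi := fun hist => (potential hist)%:R) _ potential_step).
Qed.

(* The points are fresh and the label is the less likely one of [0] and [k], so
   the expert with nonzero label [k] stays correct for [d] rounds. *)
Definition binary_state (h : adv_hist nat Y) : bool :=
  [&& (size h < d)%N, [seq e.1.1 | e <- h] == iota 0 (size h)
    & all (fun e => (e.2 == ord0) || (e.2 == ord_max)) h].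

Definition binary_label (pi : dist R Y) : Y :=
  if pi ord0 <= pi ord_max then ord0 else ord_max.

Definition binary_adversary :=
  pure_adversary binary_state size (fun _ => binary_label).

Lemma ord_max_neq0 : (ord_max : Y) != ord0.
Proof. by rewrite -val_eqE /= -lt0n. Qed.

Lemma binary_label_le (pi : dist R Y) : pi (binary_label pi) <= 2^-1.
Proof.
have : pi ord0 + pi ord_max <= 1.
  rewrite -(dist_sum1 pi) (bigD1 ord0) //= lerD2l (bigD1 ord_max) ?ord_max_neq0 //=.
  by rewrite lerDl sumr_ge0 // => y _; apply: dist_ge0.
by rewrite /binary_label; case: ifPn => [|/negP]; rewrite ?ltNge; lra.
Qed.

(** Past labels and the new one number at most [d], so the function that vanishes exactly in the
    rounds labelled [ord0], with value [ord_max] elsewhere, is a member of the class. *)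
Lemma binary_adversary_admissible : admissible P binary_adversary.
Proof.
apply: pure_adversary_admissible => h pi yh /and3P[lt_d /eqP points_h labels_h].
set y := binary_label pi; pose labels := rcons [seq e.2 | e <- h] y.
have all_labels : all (fun z => (z == ord0) || (z == ord_max)) labels.
  rewrite all_rcons all_map labels_h andbT /y /binary_label.
  by case: ifP; rewrite eqxx ?orbT.
pose z := [seq t <- iota 0 (size h).+1 | nth ord0 labels t == ord0].
have labelE t : (t <= size h)%N -> expert_of ord_max z t = nth ord0 labels t.
  move=> le_t; rewrite /expert_of mem_filter mem_iota ltnS le_t /= andbT.
  have lt_t : (t < size labels)%N by rewrite size_rcons size_map ltnS.
  have /allP/(_ _ (mem_nth ord0 lt_t)) := all_labels.
  by case: eqP => [->|_ /= /eqP].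
apply/bandit_realizableP; exists (expert_of ord_max z).
  exists ord_max; first exact: ord_max_neq0.
  apply: expert_ofP; first exact: ord_max_neq0.
  by rewrite size_filter (leq_trans (count_size _ _)) // size_iota.
rewrite consistent_rcons /= labelE // nth_rcons size_map ltnn eqxx eqxx /=.
rewrite /consistent all_map; apply/allP => e e_h /=.
suff -> : expert_of ord_max z e.1.1 = e.2 by [].
have lt_i : (index e h < size h)%N by rewrite index_mem.
have -> : e.1.1 = index e h.
  rewrite -[in LHS](nth_index e e_h) -(nth_map e 0%N (fun e => e.1.1) lt_i).
  by rewrite points_h nth_iota.
rewrite labelE 1?ltnW // nth_rcons size_map lt_i.
by rewrite (nth_map e ord0) // nth_index.
Qed.

(** Each round costs at least one half. The alternative [T == 0] covers the end of play, where the
    history may have length [d] and violate [binary_state]. *)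
Lemma exp_mistakes_binary L T h : binary_state h || (T == 0%N) -> (T + size h <= d)%N ->
  T%:R / 2 <= exp_mistakes L binary_adversary T h.
Proof.
elim: T h => [|T IH] h; first by rewrite mul0r.
rewrite orbF => Sh le_d; rewrite exp_mistakes_pure //.
set pi := L _ _; set y := binary_label pi.
apply: (@le_trans _ _ (\sum_yh pi yh * ((yh != y)%:R + T%:R / 2))).
  under eq_bigr do rewrite mulrDr.
  rewrite big_split /= -mulr_suml dist_sum1 mul1r -natr1.
  by have := binary_label_le pi; rewrite dist_sum_neq -/y; lra.
apply: ler_sum => yh _; apply: ler_wpM2l; first exact: dist_ge0.
rewrite lerD2l IH //; last by rewrite size_rcons addnS -addSn.
case/and3P: Sh => lt_d /eqP points_h labels_h; case: T le_d {IH} => [|T] le_d.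
  by rewrite orbT.
rewrite orbF /binary_state size_rcons all_rcons labels_h map_rcons points_h.
have -> : iota 0 (size h).+1 = rcons (iota 0 (size h)) (size h).
  by rewrite -addn1 iotaD cats1.
rewrite eqxx /= andbT.
apply/andP; split; first by apply: leq_trans le_d; rewrite !addSn !ltnS leq_addl.
by rewrite /y /binary_label; case: ifP; rewrite eqxx ?orbT.
Qed.

Lemma opt_bandit_adap_experts_ge_half : (0 < d)%N ->
  ((d%:R / 2)%:E <= opt_bandit_adap R P)%E.
Proof.
move=> d_gt0; apply: opt_bandit_adap_ge => L; exists binary_adversary, d.
split; first exact: binary_adversary_admissible.
by apply: exp_mistakes_binary; rewrite ?addn0 // /binary_state /= d_gt0.
Qed.

(** * Adaptive lower bound in terms of [k] *)

Definition refuted (h : adv_hist nat Y) : seq Y := [seq e.1.2 | e <- h].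

(** Every round queries the point 0, and play continues only while all predictions miss. The true
    label may change between rounds: feedback excludes only the predicted labels, so any label
    outside [refuted] can still be chosen. *)
Definition hidden_state (N : nat) (h : adv_hist nat Y) : bool :=
  (size h < N)%N && all (fun e => (e.1.1 == 0%N) && (e.1.2 != e.2)) h.

Definition hidden_label (h : adv_hist nat Y) (pi : dist R Y) : Y :=
  odflt ord0 [pick y | (y \notin refuted h) && (pi y <= 2 / k%:R)].

Definition hidden_adversary N :=
  pure_adversary (hidden_state N) (fun _ => 0%N) hidden_label.

(** More than half of [k] labels are not refuted; if each had mass above [2 / k], the total would
    exceed 1. Hence the default of [hidden_label] is not reached. *)
Lemma hidden_labelP h pi : (size h <= k %/ 2)%N ->
  hidden_label h pi \notin refuted h /\ pi (hidden_label h pi) <= 2 / k%:R.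
Proof.
move=> le_k; rewrite /hidden_label; case: pickP => [y /andP[]//|all_large].
have k_neq0 : k%:R != 0 :> R by rewrite pnatr_eq0 -lt0n.
pose A := [set y : Y | y \notin refuted h]%SET.
have cardA : (k < 2 * #|A|)%N.
  have : (#|~: A| <= size h)%N.
    rewrite -(size_map (fun e => e.1.2) h); apply: leq_trans (card_size _).
    by apply/subset_leq_card/fintype.subsetP => y; rewrite !inE negbK.
  have := cardsC A; rewrite card_ord.
  move: (k %/ 2)%N (divn_eq k 2) (ltn_pmod k (isT : 0 < 2)%N) le_k => q; lia.
suff : 1 < \sum_y pi y by rewrite dist_sum1 ltxx.
apply: (@lt_le_trans _ _ (\sum_(y in A) 2 / k%:R)).
  rewrite sumr_const -[_ *+ #|_|]mulr_natr mulrAC ltr_pdivlMr ?ltr0n // mul1r -natrM ltr_nat.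
  by [].
rewrite [leRHS](bigID [in A]) /= -[leLHS]addr0 lerD //.
  apply: ler_sum => y; rewrite inE => yA.
  by have := all_large y; rewrite yA /= => /negbT; rewrite -ltNge => /ltW.
by apply: sumr_ge0 => y _; apply: dist_ge0.
Qed.


Lemma hidden_adversary_admissible N : (0 < d)%N -> (N <= k %/ 2)%N ->
  admissible P (hidden_adversary N).
Proof.
move=> d_gt0 le_N; apply: pure_adversary_admissible => h pi yh /andP[lt_N /allP wrong_h].
have [] := hidden_labelP pi (ltnW (leq_trans lt_N le_N)).
set y := hidden_label h pi => y_alive _.
have [f Ef fy] : exists2 f, experts d f & f 0%N = y.
  (* The label [ord0] spends one zero, at the point 0, which [0 < d] allows. *)
  have [y0|yN0] := eqVneq y ord0.
    exists (expert_of ord_max [:: 0%N]); last by rewrite y0.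
    by exists ord_max; [exact: ord_max_neq0 | apply: expert_ofP; rewrite ?ord_max_neq0].
  by exists (expert_of y [::]) => //; exists y => //; apply: expert_ofP.
apply/bandit_realizableP; exists f => //; rewrite consistent_rcons /= fy eqxx /=.
rewrite /consistent all_map; apply/allP => e e_h /=.
have /andP[/eqP -> /negbTE ->] := wrong_h e e_h; rewrite fy eqbF_neg.
by apply: contraNneq y_alive => <-; apply: (map_f (fun e => e.1.2)).
Qed.

(** Each round is guessed with probability at most [2 / k], so by a union bound all [T] rounds are
    mistakes with probability at least [1 - T * (2 / k)]. *)
Lemma exp_mistakes_hidden N L T h : (N <= k %/ 2)%N ->
  hidden_state N h || (T == 0%N) -> (T + size h <= N)%N ->
  T%:R * (1 - T%:R * (2 / k%:R)) <= exp_mistakes L (hidden_adversary N) T h.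
Proof.
move=> le_N; elim: T h => [|T IH] h; first by rewrite mul0r.
rewrite orbF => Sh le_TN; rewrite exp_mistakes_pure //.
set pi := L _ _; set y := hidden_label h pi.
have y_small : pi y <= 2 / k%:R.
  have le_h : (size h <= k %/ 2)%N.
    by apply: leq_trans le_N; apply: leq_trans le_TN; rewrite leq_addl.
  by have [] := hidden_labelP pi le_h.
set V := T%:R * (1 - T%:R * (2 / k%:R)) in IH.
apply: (@le_trans _ _ (\sum_yh pi yh * (yh != y)%:R * (1 + V))).
  rewrite -mulr_suml dist_sum_neq /V -[T.+1%:R]natr1.
  have eps_ge0 : 0 <= 2 / k%:R :> R by rewrite divr_ge0 ?ler0n.
  have Teps_le1 : T%:R * (2 / k%:R) <= 1 :> R.
    rewrite mulrA ler_pdivrMr ?ltr0n // mul1r -natrM ler_nat.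
    have := leq_trunc_div k 2; nia.
  move: (T%:R) (ler0n R T) (2 / k%:R) eps_ge0 Teps_le1 y_small => t t0 e e0 te py.
  have te0 : 0 <= t * e by apply: mulr_ge0.
  have V0 : 0 <= t * (1 - t * e) by rewrite mulr_ge0 // subr_ge0.
  apply: (@le_trans _ _ ((1 - e) * (1 + t * (1 - t * e)))); last first.
    by rewrite ler_wpM2r ?addr_ge0 // lerD2l lerN2.
  (* The right side exceeds the left by [t * e + (t * e) ^ 2]. *)
  have := mulr_ge0 te0 te0; lra.
apply: ler_sum => yh _; rewrite -mulrA; apply: ler_wpM2l; first exact: dist_ge0.
have [->|yhN] := eqVneq yh y.
  (* A correct prediction violates [hidden_state] and ends the game, so nothing more is
     collected. *)
  rewrite mul0r add0r; case: T {IH le_TN V} => //= T.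
  by rewrite /hidden_state all_rcons /= eqxx andbF.
rewrite mul1r lerD2l IH ?size_rcons ?addnS -?addSn //.
case/andP: Sh => lt_N wrong_h; case: T le_TN {IH V} => [|T] le_TN.
  by rewrite orbT.
rewrite orbF /hidden_state size_rcons all_rcons /= yhN wrong_h !andbT.
by apply: leq_trans le_TN; rewrite !addSn !ltnS leq_addl.
Qed.

(** The horizon [k %/ 4] makes the union bound lose at most one half. *)
Lemma opt_bandit_adap_experts_ge_quarter : (0 < d)%N ->
  (((k %/ 4)%N%:R / 2)%:E <= opt_bandit_adap R P)%E.
Proof.
move=> d_gt0; have le_4 : (k %/ 4 <= k %/ 2)%N by apply: leq_div2l.
apply: opt_bandit_adap_ge => L; exists (hidden_adversary (k %/ 4)), (k %/ 4)%N.
split; first exact: hidden_adversary_admissible.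
apply: le_trans (exp_mistakes_hidden L le_4 (h := [::]) _ _); last 2 first.
- by rewrite /hidden_state /= andbT; case: (k %/ 4)%N.
- by rewrite addn0.
rewrite ler_wpM2l ?ler0n //.
have : (k %/ 4)%:R * (2 / k%:R) <= 2^-1 :> R.
  rewrite mulrA ler_pdivrMr ?ltr0n // ler_pdivlMl ?ltr0n // -!natrM ler_nat.
  have := leq_trunc_div k 4; lia.
lra.
Qed.

End AdaptiveAdversary.

(* Labels Y = {0,1,...,k} are 'I_k.+1; reals are Stdlib's R (a realType). *)
Theorem theorem7p1 :
  exists c C : Rdefinitions.R, (0 < c)%R /\ (c <= C)%R /\
  forall d k : nat, (1 <= d)%N -> (2 <= k)%N ->
  exists (X : Type) (H : set (X -> 'I_k.+1)),
    H !=set0 /\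
    opt_full_det Rdefinitions.R (induced_patterns H) = ((d + 1)%N%:R : Rdefinitions.R)%:E /\
    ((((c * (d * k)%N%:R)%R)%:E <= opt_bandit_det Rdefinitions.R (induced_patterns H))%E /\
     (opt_bandit_det Rdefinitions.R (induced_patterns H) <= ((C * (d * k)%N%:R)%R)%:E)%E) /\
    ((((c * (d + k)%N%:R)%R)%:E <= opt_bandit_adap Rdefinitions.R (induced_patterns H))%E /\
     (opt_bandit_adap Rdefinitions.R (induced_patterns H) <= ((C * (d + k)%N%:R)%R)%:E)%E).
Proof.
(* The constant 2 works because [1 <= d] gives both [k * d.+1 <= 2 * (d * k)] and
   [2 * k + d.+1 <= 2 * (d + k)]. *)
exists (1 / 16), 2; split; [lra | split; [lra|]] => d k d_gt0 k_ge2.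
have k_gt0 : (0 < k)%N by exact: ltnW.
exists nat, (experts d (k := k)).
split; first exact: experts_neq0.
split; first exact: opt_full_det_experts.
split; split.
- apply: le_trans (opt_bandit_det_experts_ge d _ k_gt0).
  rewrite lee_fin; have := ler0n Rdefinitions.R (d * k); lra.
- apply: le_trans (opt_bandit_det_experts_le d k _) _.
  rewrite lee_fin -natrM ler_nat; nia.
(* Eight times the larger of [d] and [k %/ 4] is at least [d + k], since [1 <= d] absorbs the
   remainder of [k] modulo 4; the factor one half in both lower bounds then gives 1/16. *)
- have [le_d|lt_d] := leqP (k %/ 4) d.
    apply: le_trans (opt_bandit_adap_experts_ge_half _ k_gt0 d_gt0).
    have : ((d + k)%:R <= (8 * d)%:R :> Rdefinitions.R)%R.
      rewrite ler_nat; have := divn_eq k 4; have := ltn_pmod k (isT : 0 < 4)%N; lia.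
    by rewrite lee_fin natrM; lra.
  apply: le_trans (opt_bandit_adap_experts_ge_quarter _ k_gt0 d_gt0).
  have : ((d + k)%:R <= (8 * (k %/ 4))%:R :> Rdefinitions.R)%R.
    rewrite ler_nat; have := divn_eq k 4; have := ltn_pmod k (isT : 0 < 4)%N; lia.
  by rewrite lee_fin natrM; lra.
- apply: le_trans (opt_bandit_adap_experts_le _ d k_gt0) _.
  rewrite lee_fin -natrM ler_nat; lia.
Qed.
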